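(* Let $\mathcal{U}$ be a right Lebesgue-ultrafilter on $\mathbb{R}$. Then the functional $\mathcal{B}\lim_{\mathcal{U}}:L^\infty(\mathbb{R})\to\mathbb{R}$ defined by $\mathcal{B}\lim_{\mathcal{U}}u:=\lim_{\mathcal{U}}\widehat{u}$ is a (right) Banach limit.
   Context: $L^\infty(\mathbb{R})$ is the usual space of essentially bounded Lebesgue measurable functions $\mathbb{R}\to\mathbb{R}$ modulo almost everywhere equality. $B_\varepsilon(l)$ is the open interval $(l-\varepsilon,l+\varepsilon)$, and $A^\complement:=\mathbb{R}\setminus A$. A filter on $\mathbb{R}$ is a family $\mathcal{F}$ of subsets of $\mathbb{R}$ with $\mathbb{R}\in\mathcal{F}$, $\emptyset\notin\mathcal{F}$, closed under finite intersections and under supersets in $\mathbb{R}$. An ultrafilter is a filter $\mathcal{U}$ such that for all $A\subseteq\mathbb{R}$ either $A\in\mathcal{U}$ or $A^\complement\in\mathcal{U}$. An ultrafilter $\mathcal{U}$ is a Lebesgue-ultrafilter if $N^\complement\in\mathcal{U}$ for every Lebesgue-null set $N\subseteq\mathbb{R}$, and a right ultrafilter if $(a,\infty)\in\mathcal{U}$ for all $a\in\mathbb{R}$. A right Lebesgue-ultrafilter is an ultrafilter that is both. For a Lebesgue-ultrafilter $\mathcal{U}$ and $v\in L^\infty(\mathbb{R})$, $\lim_{\mathcal{U}}v$ is the (unique, representative-independent) real number $l$ such that $\{x\in\mathbb{R}: v(x)\in B_\varepsilon(l)\}\in\mathcal{U}$ for all $\varepsilon>0$. The Cesàro-like average of a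 bounded measurable $u:\mathbb{R}\to\mathbb{R}$ is $\widehat{u}(0):=u(0)$ and $\widehat{u}(x):=\frac1x\int_0^x u(y)\,dy$ for $x\neq0$ (with $\int_a^b:=-\int_{[b,a]}$ if $b<a$); it induces an operator $\widehat{\cdot}:L^\infty(\mathbb{R})\to L^\infty(\mathbb{R})$. For $t\in\mathbb{R}$, $\mathcal{T}_tu(x):=u(x-t)$. For $u\in L^\infty(\mathbb{R})$, $\lim_{x\to\infty}u(x)=l$ means: for all $\varepsilon>0$ there is $a\in\mathbb{R}$ such that $u(x)\in B_\varepsilon(l)$ for almost every $x>a$. A linear functional $\phi:L^\infty(\mathbb{R})\to\mathbb{R}$ is a (right) Banach limit if: (i) $\phi(u)\ge0$ whenever $u\ge0$ almost everywhere; (ii) $\phi(\mathcal{T}_tu)=\phi(u)$ for all $u\in L^\infty(\mathbb{R})$ and $t\in\mathbb{R}$; (iii) $\phi(u)=\lim_{x\to\infty}u(x)$ whenever the latter limit exists. *)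

(* Defs.v *)
From HB Require Import structures.
From mathcomp Require Import all_boot all_order all_algebra.
From mathcomp Require Import generic_quotient ring_quotient.
From mathcomp Require Import all_classical all_reals all_analysis.
From mathcomp Require Import measurable_realfun ess_sup_inf.
From mathcomp Require Import lra.

Set Implicit Arguments.
Unset Strict Implicit.
Unset Printing Implicit Defensive.

Import Order.TTheory GRing.Theory Num.Theory.
Import numFieldNormedType.Exports.

Local Open Scope classical_set_scope.
Local Open Scope ring_scope.
Local Open Scope quotient_scope.

(* The real line with the Lebesgue (that is, Caratheodory) sigma-algebra, which
   is the completion of the Borel one. *)
Definition lebR (R : realType) : Type :=
  caratheodory_type (@wlength R idfun)^*%mu.
HB.instance Definition _ (R : realType) := Measurable.on (lebR R).

Definition leb (R : realType) : {measure set (lebR R) -> \bar R} :=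
  @completed_lebesgue_measure R.

Lemma leb_setT_gt0 (R : realType) : (0 < leb R [set: R])%E.
Proof.
have -> : leb R [set: R] = (@lebesgue_measure R) [set` `]-oo, +oo[ ].
  by rewrite set_itvE.
by rewrite lebesgue_measure_itv /= addye // lt0y.
Qed.

#[global] Instance leb_ae_filter (R : realType) :
  ProperFilter (almost_everywhere (leb R)).
Proof. exact: ae_properfilter_algebraOfSetsType (leb_setT_gt0 R). Qed.

Section Shift.
Variable R : realType.
Implicit Types (t : R) (A : set R).

Definition translf t (u : R -> R) : R -> R := fun x => u (x - t).

Let sh t (x : R) : R := x - t.

Let sh_preimage_itv t (a b : R) :
  sh t @^-1` `]a, b]%classic = `]a + t, b + t]%classic.
Proof.
by apply/seteqP; split=> x /=; rewrite !in_itv/= /sh ltrBrDr lerBlDr.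
Qed.

Let wlength_sh t (A : set R) : ocitv A ->
  wlength idfun (sh t @^-1` A) = wlength idfun A :> \bar R.
Proof.
move=> /ocitvP[->|[[a b]/= ab ->]]; first by rewrite preimage_set0.
rewrite sh_preimage_itv !wlength_itv_bnd ?lerD2r ?(ltW ab)//=.
by rewrite opprD addrACA subrr addr0.
Qed.

Let leb_sh_le t A : (leb R (sh t @^-1` A) <= leb R A :> \bar R)%E.
Proof.
apply: le_ereal_inf_tmp => _ [F [mF AF] <-] /=.
apply: ereal_inf_lbound; exists (fun k => sh t @^-1` (F k)).
  split=> [k|x /= /AF[k _ Fk]]; last by exists k.
  have /= [[a b] _ <-] := mF k.
  by rewrite sh_preimage_itv; apply: is_ocitv.
by apply: eq_eseriesr => k _; exact: (wlength_sh t (mF k)).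
Qed.

Lemma leb_shift t A : leb R ((fun x => x - t) @^-1` A) = leb R A :> \bar R.
Proof.
apply/eqP; rewrite eq_le leb_sh_le/=.
have := leb_sh_le (- t) (sh t @^-1` A).
rewrite -comp_preimage (_ : _ \o _ = id)//.
by apply/funext => x /=; rewrite /sh opprK addrK.
Qed.

Lemma measurable_subl t :
  measurable_fun setT ((fun x => x - t) : lebR R -> lebR R).
Proof.
have carE (B : set (lebR R)) : measurable B <->
  forall X : set R, leb R X = (leb R (X `&` B) + leb R (X `&` ~` B))%E :> \bar R by [].
move=> _ A /carE mA; rewrite setTI; apply/carE => X.
pose Y : set R := (fun x => x - - t) @^-1` X.
have YX : (fun x => x - t) @^-1` Y = X.
  by rewrite /Y -comp_preimage (_ : _ \o _ = id)// funeqE => x /=; rewrite opprK subrK.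
have e (Z : set R) : X `&` (fun x => x - t) @^-1` Z = (fun x => x - t) @^-1` (Y `&` Z).
  by rewrite -YX.
have -> : leb R X = leb R Y :> \bar R by rewrite leb_shift.
rewrite (mA Y).
congr (_ + _)%E.
  by rewrite e leb_shift.
by rewrite [X `&` _](e (~` A)) leb_shift.
Qed.

Lemma ae_shift t (P : R -> Prop) :
  (\forall x \ae (leb R), P x) -> \forall x \ae (leb R), P (x - t).
Proof.
move=> [A [mA A0 PA]]; exists ((fun x => x - t) @^-1` A); split.
- by have := measurable_subl t measurableT mA; rewrite setTI.
- by rewrite leb_shift.
- by move=> x /= Px; apply: PA.
Qed.

End Shift.

Notation essb R := (LfunType (leb R) (leey 1%E)).

Section EssBounded.
Variable R : realType.
Implicit Types (u v : R -> R).

Definition essentially_bounded u :=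
  exists M : R, \forall x \ae (leb R), `|u x| <= M.

Lemma finite_normyP u :
  finite_norm (leb R) +oo%E u <-> essentially_bounded u.
Proof.
rewrite /finite_norm unlock /Lnorm (leb_setT_gt0 R); split=> [|[M uM]].
- have /ess_supP := lexx (ess_sup (leb R) (abse \o (EFin \o u))).
  have : (0 <= ess_sup (leb R) (abse \o (EFin \o u)))%E.
    by apply: (ess_sup_gee (leb_setT_gt0 R)); apply: nearW => x; exact: abse_ge0.
  case: (ess_sup _ _) => // M _ uM _; exists M.
  by apply: filterS uM => x.
- apply: (@le_lt_trans _ _ M%:E); last exact: ltry.
  by apply/ess_supP; apply: (@filterS _ _ (leb_ae_filter R)) uM.
Qed.

Definition mkessb u (mu_ : measurable_fun [set: lebR R] u)
    (bu : essentially_bounded u) : essb R :=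
  @Lfun_Sub _ (lebR R) R (leb R) +oo%E (leey 1%E) u
    (introT andP (conj (mem_set mu_) (mem_set ((finite_normyP u).2 bu)))).

Lemma mkessbE u mu_ bu : (@mkessb u mu_ bu : R -> R) = u.
Proof. by []. Qed.

Lemma essb_measurable (f : essb R) : measurable_fun [set: lebR R] f.
Proof. exact: measurable_funPT. Qed.

Lemma essb_bounded (f : essb R) : essentially_bounded f.
Proof. by apply/finite_normyP; exact: Lfunction_finite. Qed.

Definition ae_null : {pred essb R} :=
  mem [set f : essb R | f = cst 0 %[ae leb R]].

Lemma ae_null_zmod : zmod_closed ae_null.
Proof.
split=> [|f g]; first by rewrite inE/=; apply: nearW.
rewrite !inE/= => f0 g0; apply: filterS2 f0 g0 => x /= f0 g0 _.
by change (f x - g x = 0); rewrite f0// g0// subr0.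
Qed.
HB.instance Definition _ := GRing.isZmodClosed.Build _ ae_null ae_null_zmod.

Definition Linf : Type := Quotient.quot ae_null.
HB.instance Definition _ := GRing.Zmodule.on Linf.
HB.instance Definition _ := EqQuotient.on Linf.

Lemma Linf_eqP (f g : essb R) :
  f = g %[mod Linf] <-> f = g %[ae leb R].
Proof.
split=> [/eqP|fg].
  rewrite -Quotient.idealrBE inE/=; apply: filterS => x /= fg Dx.
  by apply/eqP; rewrite -subr_eq0; apply/eqP; exact: fg.
apply/eqP; rewrite -Quotient.idealrBE inE/=.
by apply: filterS fg => x /= fg Dx; change (f x - g x = 0); rewrite fg// subrr.
Qed.

Lemma repr_ae (f : essb R) : repr (\pi_Linf f) = f %[ae leb R].
Proof. by apply/Linf_eqP; rewrite reprK. Qed.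

Definition scaleq (a : R) := lift_op1 Linf ( *:%R a).

Lemma pi_scale a : {morph \pi_Linf : f / a *: f >-> scaleq a f}.
Proof.
move=> f; unlock scaleq; apply/Linf_eqP.
apply: filterS (repr_ae f) => x /= fx Dx.
by change (a * f x = a * repr (\pi_Linf f) x); rewrite fx.
Qed.

Let scaleqA (a b : R) (u : Linf) : scaleq a (scaleq b u) = scaleq (a * b) u.
Proof. by rewrite -[u]reprK -!pi_scale scalerA. Qed.

Let scale1q : left_id 1 scaleq.
Proof. by move=> u; rewrite -[u]reprK -pi_scale scale1r. Qed.

Lemma piD (f g : essb R) : \pi_Linf (f + g) = \pi_Linf f + \pi_Linf g.
Proof. exact: Quotient.pi_add. Qed.

Let scaleqDr : right_distributive scaleq +%R.
Proof.
by move=> a u v; rewrite -[u]reprK -[v]reprK -!(piD, pi_scale) scalerDr.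
Qed.

Let scaleqDl (u : Linf) : {morph scaleq^~ u : a b / a + b}.
Proof.
by move=> a b; rewrite -[u]reprK -!(piD, pi_scale) scalerDl.
Qed.

HB.instance Definition _ :=
  GRing.Zmodule_isLmodule.Build R Linf scaleqA scale1q scaleqDr scaleqDl.

Lemma piZ a (f : essb R) : \pi_Linf (a *: f) = a *: \pi_Linf f.
Proof. exact: pi_scale. Qed.

End EssBounded.

(* A chosen representative, meaningful only up to a.e. equality: see repr_ae. *)
Definition Linf_fun (R : realType) (u : Linf R) : R -> R := repr u.
Coercion Linf_fun : Linf >-> Funclass.

Section Translation.
Variable R : realType.
Implicit Types (t : R) (f : essb R) (u : Linf R).

Lemma shift_measurable t f : measurable_fun [set: lebR R] (translf t f).
Proof.
exact: (measurableT_comp (essb_measurable f) (@measurable_subl R t)).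
Qed.

Lemma shift_bounded t f : essentially_bounded (translf t f).
Proof. by have [M /(ae_shift t) fM] := essb_bounded f; exists M. Qed.

Definition translate t u : Linf R :=
  \pi_(Linf R) (mkessb (shift_measurable t (repr u)) (shift_bounded t (repr u))).

Lemma translate_pi t f : translate t (\pi_(Linf R) f) = translf t f %[ae leb R].
Proof.
have h2 := ae_shift t (repr_ae f); have h1 := repr_ae (mkessb
  (shift_measurable t (repr (\pi_(Linf R) f)))
  (shift_bounded t (repr (\pi_(Linf R) f)))).
apply: filterS2 h1 h2 => x /= h1 h2 Dx.
by rewrite /Linf_fun /translate h1// /translf h2.
Qed.

End Translation.

Section Cesaro.
Variable R : realType.
Implicit Types (f g : essb R) (a b c x : R).

Definition oint a b (u : R -> R) : R :=
  if a <= b then \int[leb R]_(y in `[a, b]) u y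
  else - \int[leb R]_(y in `[b, a]) u y.

Definition cesaro (u : R -> R) : R -> R :=
  fun x => if x == 0 then u 0 else x^-1 * oint 0 x u.

Let borel_leb (A : set R) : measurable A -> measurable (A : set (lebR R)).
Proof. 
move=> mA; apply: sub_caratheodory.
exact: mA. Qed.

Let itv_leb (i : interval R) : measurable ([set` i] : set (lebR R)).
Proof. exact: borel_leb. Qed.

Let leb_itv (i : interval R) : leb R [set` i] = lebesgue_measure [set` i].
Proof. by []. Qed.

Let leb_cc a b : a <= b -> leb R [set` `[a, b]] = (b - a)%:E.
Proof.
move=> ab; rewrite leb_itv lebesgue_measure_itv/= lte_fin.
by case: ltgtP ab => // -> _; rewrite subrr.
Qed.

Let essM_ge0 f (M : R) : (\forall x \ae leb R, `|f x| <= M) -> 0 <= M.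
Proof. by move=> /filter_ex[x]; apply: le_trans. Qed.

Let mf_itv f a b : measurable_fun ([set` `[a, b]] : set (lebR R)) f.
Proof. exact: measurable_funTS (essb_measurable f). Qed.

Let abs_bnd f (M : R) a b : (\forall x \ae leb R, `|f x| <= M) -> a <= b ->
  (\int[leb R]_(y in [set` `[a, b]]) `|(f y)%:E| <= (M * (b - a))%:E)%E.
Proof.
move=> fM ab; have M0 := essM_ge0 fM.
apply: (@le_trans _ _ (\int[leb R]_(y in [set` `[a, b]]) (cst M%:E y)))%E.
  apply: ae_ge0_le_integral => //.
  - have /measurable_EFinP h := @mf_itv f a b.
    exact: (measurableT_comp (@abse_measurable R [set: \bar R]) h).
  - by apply: filterS fM => x fM _; rewrite /= lee_fin.
rewrite integral_cst//.
by rewrite [X in (_ * X)%E]leb_cc// EFinM.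
Qed.

Lemma essb_integrable f a b : (leb R).-integrable [set` `[a, b]] (EFin \o f).
Proof.
apply/integrableP; split; first exact/measurable_EFinP.
have [M fM] := essb_bounded f.
have [ab|ba] := leP a b; first exact: le_lt_trans (abs_bnd fM ab) (ltry _).
rewrite set_itv_ge ?integral_set0//.
by rewrite bnd_simp -ltNge.
Qed.

Let int_bound f (M : R) a b : (\forall x \ae leb R, `|f x| <= M) -> a <= b ->
  `|\int[leb R]_(y in [set` `[a, b]]) f y| <= M * (b - a).
Proof.
move=> fM ab; apply: le_trans (le_normr_Rintegral _ (essb_integrable f a b)) _ => //.
have h := abs_bnd fM ab.
rewrite -lee_fin fineK; first exact: h.
by rewrite ge0_fin_numE; [exact: le_lt_trans h (ltry _)|exact: integral_ge0].
Qed.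

Let int_chasles f a b c : a <= b -> b <= c ->
  \int[leb R]_(y in [set` `[a, c]]) f y =
  \int[leb R]_(y in [set` `[a, b]]) f y + \int[leb R]_(y in [set` `[b, c]]) f y.
Proof.
move=> ab bc.
have -> : \int[leb R]_(y in [set` `[b, c]]) f y =
          \int[leb R]_(y in [set` `]b, c]]) f y.
  have b0 : leb R [set b] = 0%E by exact: lebesgue_measure_set1.
  rewrite /Rintegral (negligible_integral _ _ (essb_integrable f b c) b0)//.
    by rewrite setDitv1l.
  exact: (borel_leb (measurable_set1 b)).
have E : [set` `[a, c]] = [set` `[a, b]] `|` [set` `]b, c]].
  by rewrite -itv_bndbnd_setU// bnd_simp.
rewrite E Rintegral_setU//.
  by rewrite -[X in _.-integrable X _]E; exact: essb_integrable.
apply/disj_set2P/seteqP; split=> x //= [].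
by rewrite !in_itv/= => /andP[_ xb] /andP[bx _]; lra.
Qed.

Let oint_chasles f a b c : oint a c f = oint a b f + oint b c f.
Proof.
rewrite /oint.
case: (leP a b) => ab; case: (leP b c) => bc; case: (leP a c) => ac;
  try (exfalso; lra).
- exact: int_chasles.
- by have := int_chasles f ac (ltW bc); lra.
- by have := int_chasles f (ltW ac) ab; lra.
- by have := int_chasles f (ltW ab) ac; lra.
- by have := int_chasles f bc (ltW ac); lra.
- by have := int_chasles f (ltW bc) (ltW ab); lra.
Qed.

Lemma oint_bound f (M : R) a b : (\forall x \ae leb R, `|f x| <= M) ->
  `|oint a b f| <= M * `|b - a|.
Proof.
move=> fM; rewrite /oint; case: (leP a b) => [ab|/ltW ba].
  by rewrite [X in _ * X]ger0_norm ?subr_ge0//; exact: int_bound.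
by rewrite normrN distrC [X in _ * X]ger0_norm ?subr_ge0//; exact: int_bound.
Qed.

Lemma oint_continuous f : continuous (oint 0 ^~ f).
Proof.
have [M fM] := essb_bounded f; have M0 := essM_ge0 fM.
move=> x; apply/cvgrPdist_le => e e0; near=> y.
have -> : oint 0 x f - oint 0 y f = oint y x f.
  by rewrite (oint_chasles f 0 y x) addrAC subrr add0r.
apply: le_trans (oint_bound _ _ fM) _.
rewrite (@le_trans _ _ ((M + 1) * `|x - y|))//.
  by rewrite ler_wpM2r// lerDl.
rewrite -ler_pdivlMl ?ltr_wpDl//.
near: y; apply: cvgr_dist_le; first exact: cvg_id.
by rewrite mulr_gt0// invr_gt0 ltr_wpDl.
Unshelve. all: by end_near. Qed.

Lemma cesaro_measurable f : measurable_fun [set: lebR R] (cesaro f).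
Proof.
have idm : measurable_fun [set: lebR R] (id : lebR R -> R).
  by move=> _ A mA; rewrite setTI; exact: borel_leb.
apply: (measurableT_comp (f := cesaro f : R -> R) _ idm).
apply: measurable_fun_if => //.
- by apply: measurable_fun_eqr.
rewrite setTI.
have -> : (eq_op^~ 0 @^-1` [set false] : set R) = [set x | x != 0].
  by apply/seteqP; split=> x /=; case: eqP.
apply: open_continuous_measurable_fun; first exact: open_neq.
move=> x /set_mem/= x0; apply: cvgM; last exact: oint_continuous.
by apply: cvgV.
Qed.

Lemma cesaro_bounded f : essentially_bounded (cesaro f).
Proof.
have [M fM] := essb_bounded f; have M0 := essM_ge0 fM.
exists (Num.max `|f 0| M); apply: nearW => x; rewrite /cesaro le_max.
case: eqP => [_|/eqP x0]; first by rewrite lexx.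
apply/orP; right; rewrite normrM normfV ler_pdivrMl ?normr_gt0//.
by have := oint_bound 0 x fM; rewrite subr0 mulrC.
Qed.

Lemma oint_ae f g a b : f = g %[ae leb R] -> oint a b f = oint a b g.
Proof.
move=> fg.
have h c d : \int[leb R]_(y in [set` `[c, d]]) f y =
             \int[leb R]_(y in [set` `[c, d]]) g y.
  congr fine; apply: ae_eq_integral => //.
  - by apply/measurable_EFinP; exact: mf_itv.
  - by apply/measurable_EFinP; exact: mf_itv.
  - by apply: filterS fg => x fg _; rewrite fg.
by rewrite /oint !h.
Qed.

Definition cesaroL (u : Linf R) : Linf R :=
  \pi_(Linf R) (mkessb (cesaro_measurable (repr u)) (cesaro_bounded (repr u))).

Lemma cesaroL_pi f : cesaroL (\pi_(Linf R) f) = cesaro f %[ae leb R].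
Proof.
have h := repr_ae (mkessb (cesaro_measurable (repr (\pi_(Linf R) f)))
  (cesaro_bounded (repr (\pi_(Linf R) f)))).
apply: filterS2 h (repr_ae f) => x /= h fx Dx.
rewrite /Linf_fun /cesaroL h// /cesaro.
case: eqP => [x0|_]; last by rewrite (oint_ae _ _ (repr_ae f)).
by rewrite x0 in fx; exact: fx.
Qed.

End Cesaro.

Section Ultrafilters.
Variable R : realType.
Implicit Types (U : set_system R) (u : Linf R).

Definition lebesgue_ultrafilter U :=
  UltraFilter U /\ forall N : set (lebR R), (leb R).-negligible N -> U (~` N).

Definition right_ultrafilter U :=
  UltraFilter U /\ forall a : R, U `]a, +oo[%classic.

Definition right_lebesgue_ultrafilter U :=
  lebesgue_ultrafilter U /\ right_ultrafilter U.

(* The library defines ultrafilters by maximality. *)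
Lemma ultrafilterP U :
  UltraFilter U <-> ProperFilter U /\ forall A, U A \/ U (~` A).
Proof.
split=> [UU|[PU UA]].
  by split; [exact: ultra_proper|move=> A; exact: in_ultra_setVsetC].
split=> // G PG UG; apply/seteqP; split=> // A GA.
have [//|/UG GCA] := UA A.
by exfalso; apply: (@filter_not_empty _ G); rewrite -(setICr A); exact: filterI.
Qed.

Lemma lebesgue_ultrafilter_ae U (P : R -> Prop) : lebesgue_ultrafilter U ->
  (\forall x \ae leb R, P x) -> U [set x | P x].
Proof. by move=> [_ UN] /UN; rewrite setCK. Qed.

(* As a total function this is junk when there is no limit; ulimP shows that for
   a Lebesgue ultrafilter the limit exists, is unique, and does not depend on the
   representative. *)
Definition ulim U u : R := lim (u x @[x --> U]).

Lemma ulimP U (f : essb R) (l : R) : lebesgue_ultrafilter U ->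
  ulim U (\pi_(Linf R) f) = l <->
  forall e : R, 0 < e -> U [set x | ball l e (f x)].
Proof.
move=> LU; have [UU _] := LU; pose u : Linf R := \pi_(Linf R) f.
have PU : ProperFilter U by exact: ultra_proper.
have UE : U [set x | u x = f x].
  apply: (lebesgue_ultrafilter_ae LU).
  by apply: filterS (repr_ae f) => x; apply.
have cvgE l' : u x @[x --> U] --> l' <-> forall e : R, 0 < e -> U [set x | ball l' e (f x)].
  split=> [/cvg_ballP ul e e0|fl].
    by apply: filterS2 UE (ul e e0) => x /= <-.
  by apply/cvg_ballP => e e0; apply: filterS2 UE (fl e e0) => x /= <-.
have [l0 ul0] : exists l0 : R, u x @[x --> U] --> l0.
  have [M uM] := essb_bounded (repr u).
  have UF : UltraFilter (u x @[x --> U]).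
    apply/ultrafilterP; split; first exact: fmap_proper_filter.
    by move=> A; exact: (@in_ultra_setVsetC _ U (u @^-1` A) UU).
  have := @segment_compact R (- M) M; rewrite compact_ultra => /(_ _ UF).
  case; last by move=> l0 [_ ?]; exists l0.
  apply: filterS (lebesgue_ultrafilter_ae LU uM) => x /=.
  by move=> h; rewrite in_itv/= -ler_norml; exact: h.
split=> [<-|/cvgE ul]; last exact/cvg_lim.
by apply/cvgE; rewrite /ulim (cvg_lim _ ul0).
Qed.

Definition Blim U u : R := ulim U (cesaroL u).

Definition Linf_cvg_pinfty u (l : R) := forall e : R, 0 < e ->
  exists a : R, \forall x \ae leb R, a < x -> ball l e (u x).

Record banach_limit (phi : Linf R -> R) : Prop := {
  banach_limit_linear : scalar phi ;
  banach_limit_ge0 : forall u, (\forall x \ae leb R, 0 <= u x) -> 0 <= phi u ;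
  banach_limit_translate : forall u t, phi (translate t u) = phi u ;
  banach_limit_cvg : forall u l, Linf_cvg_pinfty u l -> phi u = l }.

End Ultrafilters.

(* Main.v *)
Require Import Defs.
From mathcomp Require Import all_boot all_order all_algebra.
From mathcomp Require Import all_classical all_reals all_analysis.
From mathcomp Require Import measurable_realfun lra.

(** Along a right ultrafilter a bounded quantity divided by [x] tends to 0. The
    integrals over [0, x] of [u] and of its translate by [t] differ by two
    integrals over intervals of length [|t|], hence by a bounded quantity, so
    the averages have the same limit; likewise, if [u] is a.e. within [e] of [l]
    beyond [a], the integral over [0, a] contributes nothing in the limit. *)

Local Open Scope classical_set_scope.
Local Open Scope ring_scope.

Import Order.TTheory GRing.Theory Num.Theory.
Import numFieldNormedType.Exports.

(** Removing from [D] a null set [N] that contains every exception changes neither integral, and on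
    [D] minus [N] the comparison is pointwise. *)
Lemma le_Rintegral_ae {d} {T : measurableType d} {R : realType}
    (mu : {measure set T -> \bar R}) (D : set T) (f g : T -> R) :
  measurable D ->
  mu.-integrable D (EFin \o f) -> mu.-integrable D (EFin \o g) ->
  (\forall x \ae mu, D x -> f x <= g x) ->
  \int[mu]_(x in D) f x <= \int[mu]_(x in D) g x.
Proof.
move=> mD intf intg [N [mN muN fgN]].
have mDN : measurable (D `\` N) by exact: measurableD.
have intDN (h : T -> R) : mu.-integrable D (EFin \o h) ->
    mu.-integrable (D `\` N) (EFin \o h).
  by apply: integrableS => // x [].
have -> : \int[mu]_(x in D) f x = \int[mu]_(x in D `\` N) f x.
  by congr fine; exact: negligible_integral.
have -> : \int[mu]_(x in D) g x = \int[mu]_(x in D `\` N) g x.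
  by congr fine; exact: negligible_integral.
apply: le_Rintegral => //; [exact: intDN|exact: intDN|].
move=> x [Dx Nx]; apply: contrapT => fgx; apply: Nx; apply: fgN => /= fg.
exact: fgx (fg Dx).
Qed.

Section OrientedIntegral.
Context {R : realType}.
Implicit Types (f g : essb R) (a b c x t l : R).

Lemma measurable_itv_lebR (i : interval R) : measurable ([set` i] : set (lebR R)).
Proof. by apply: sub_caratheodory; exact: (measurable_itv i). Qed.
Local Hint Resolve measurable_itv_lebR : core.

Lemma leb_itvcc a b : a <= b -> leb R `[a, b]%classic = (b - a)%:E.
Proof.
move=> ab; have -> : leb R `[a, b]%classic = lebesgue_measure `[a, b]%classic by [].
rewrite lebesgue_measure_itv/= lte_fin.
by case: ltgtP ab => // -> _; rewrite subrr.
Qed.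

Lemma oint_cst a b l : a <= b -> oint a b (cst l) = l * (b - a).
Proof. by move=> ab; rewrite /oint ab Rintegral_cst// leb_itvcc. Qed.

Lemma integrable_cst_itv a b l : (leb R).-integrable `[a, b]%classic (EFin \o cst l).
Proof.
have b1 : essentially_bounded (cst l : R -> R) by exists `|l|; exact: nearW.
exact: (essb_integrable (mkessb (measurable_cst l) b1) a b).
Qed.

Lemma oint_ge_ae f a b l : a <= b ->
  (\forall x \ae leb R, a <= x <= b -> l <= f x) -> l * (b - a) <= oint a b f.
Proof.
move=> ab lf; rewrite -oint_cst// /oint ab; apply: le_Rintegral_ae => //.
- exact: integrable_cst_itv.
- exact: essb_integrable.
Qed.

Lemma oint_le_ae f a b l : a <= b ->
  (\forall x \ae leb R, a <= x <= b -> f x <= l) -> oint a b f <= l * (b - a).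
Proof.
move=> ab lf; rewrite -oint_cst// /oint ab; apply: le_Rintegral_ae => //.
- exact: essb_integrable.
- exact: integrable_cst_itv.
Qed.

Lemma oint_scalar f g a b l :
  oint a b (l *: f + g) = l * oint a b f + oint a b g.
Proof.
have E c d : \int[leb R]_(y in `[c, d]) (l *: f + g) y =
    l * (\int[leb R]_(y in `[c, d]) f y) + \int[leb R]_(y in `[c, d]) g y.
  rewrite -RintegralZl//; last exact: essb_integrable.
  rewrite -RintegralD//; last exact: essb_integrable.
  exact: (essb_integrable (l *: f) c d).
by rewrite /oint !E; case: ifP => // _; rewrite mulrN opprD.
Qed.

(** The closed intervals share the point [b]; it is null, so deleting it from the second one makes
    the union disjoint at no cost. *)
Lemma Rintegral_itv_split f a b c : a <= b -> b <= c ->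
  \int[leb R]_(y in `[a, c]) f y =
  \int[leb R]_(y in `[a, b]) f y + \int[leb R]_(y in `[b, c]) f y.
Proof.
move=> ab bc; pose I : set (lebR R) := `[a, c]%classic.
have IE : I = `[a, b]%classic `|` (`[b, c]%classic `\ b).
  by rewrite setDitv1l -itv_bndbnd_setU// bnd_simp.
have mb : measurable ([set b] : set (lebR R)) by rewrite -set_itv1.
have -> : \int[leb R]_(y in `[b, c]) f y =
          \int[leb R]_(y in `[b, c]%classic `\ b) f y.
  congr fine; apply: negligible_integral => //; first exact: essb_integrable.
  exact: lebesgue_measure_set1.
rewrite -/I IE Rintegral_setU//; first exact: measurableD.
- by rewrite -IE; exact: essb_integrable.
- apply/disj_set2P/seteqP; split=> x //= [].
  by rewrite !in_itv/= => /andP[_ xb] [/andP[bx _]]; apply; lra.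
Qed.

(** Of the eight sign patterns two are contradictory; each of the others is the unoriented splitting
    at the middle point, rearranged linearly. *)
Lemma oint_split f a b c : oint a c f = oint a b f + oint b c f.
Proof.
have S := Rintegral_itv_split f; rewrite /oint.
case: (leP a b) => ab; case: (leP b c) => bc; case: (leP a c) => ac;
  try (exfalso; lra).
- exact: S.
- by have := S _ _ _ ac (ltW bc); lra.
- by have := S _ _ _ (ltW ac) ab; lra.
- by have := S _ _ _ (ltW ab) ac; lra.
- by have := S _ _ _ bc (ltW ac); lra.
- by have := S _ _ _ (ltW bc) (ltW ab); lra.
Qed.

Lemma oint_translf f a b t : oint a b (translf t f) = oint (a - t) (b - t) f.
Proof.
have E c d : \int[leb R]_(y in `[c, d]) translf t f y =
    \int[leb R]_(y in `[c - t, d - t]) f y.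
  pose s : lebR R -> lebR R := fun x => x - t.
  have ms : measurable_fun [set: lebR R] s by exact: measurable_subl.
  have sE : s @^-1` `[c - t, d - t]%classic = `[c, d]%classic.
    by apply/seteqP; split=> x /=; rewrite !in_itv/= !lerD2r.
  congr fine.
  pose D : set (lebR R) := `[c - t, d - t]%classic.
  (* Change of variables along [s]: by translation invariance the pushforward of [leb R] is [leb R]
     itself. *)
  transitivity (\int[pushforward (leb R) s]_(y in D) (f y)%:E)%E.
    rewrite (integral_pushforward ms)//; first by rewrite sE.
    - exact/measurable_EFinP/essb_measurable.
    - rewrite sE.
      exact: (essb_integrable (mkessb (shift_measurable t f) (shift_bounded t f))).
    - exact: measurable_itv_lebR.
  by congr (integral _ D _); apply/funext => A; exact: leb_shift.
by rewrite /oint !E lerD2r.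
Qed.

End OrientedIntegral.

Section Averages.
Context {R : realType} {U : set_system R}
  (RLU : right_lebesgue_ultrafilter U).
Implicit Types (f : essb R) (u : Linf R).

#[local] Instance right_lebesgue_proper : ProperFilter U.
Proof. by apply: ultra_proper; have [[]] := RLU. Qed.

Lemma right_gt (a : R) : U [set x | a < x].
Proof.
by have [_ [_ /(_ a)]] := RLU; apply: filterS => x; rewrite /= in_itv/= andbT.
Qed.

(** Links the limit on classes to honest averages of any representative: integrals ignore null sets,
    and the special value of the average at 0 is avoided because [U] contains the positive
    half-line. *)
Lemma cvg_Blim f :
  x^-1 * oint 0 x f @[x --> U] --> Blim U (\pi_(Linf R) f)%qT.
Proof.
have [LU _] := RLU.
pose g := repr (\pi_(Linf R) f)%qT.
(* [erefl] suffices because [cesaroL] of a class is by definition the class of [cesaro g]. *)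
have [/(_ erefl) Ug _] :=
  ulimP (mkessb (cesaro_measurable g) (cesaro_bounded g))
    (Blim U (\pi_(Linf R) f)%qT) LU.
apply/cvg_ballP => e /Ug; apply: filterS2 (right_gt 0) => x x0.
by rewrite mkessbE /= /Defs.cesaro gt_eqF// (oint_ae _ _ (repr_ae f)).
Qed.

Lemma cvg_div_bounded (h : R -> R) (K : R) :
  (forall x, `|h x| <= K) -> x^-1 * h x @[x --> U] --> (0 : R).
Proof.
move=> hK; apply/cvgrPdist_lt => e e0.
(* Beyond [K / e] one has [K < e * x]. *)
apply: filterS2 (right_gt 0) (right_gt (K / e)) => x /= x0 Kx.
rewrite sub0r normrN normrM normfV (gtr0_norm x0).
rewrite ltr_pdivrMl//; apply: le_lt_trans (hK x) _.
by rewrite -ltr_pdivrMr.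
Qed.

Lemma Blim_eq f l : x^-1 * oint 0 x f @[x --> U] --> l ->
  Blim U (\pi_(Linf R) f)%qT = l.
Proof. exact: cvg_unique (cvg_Blim f). Qed.

Lemma Blim_scalar : scalar (Blim U).
Proof.
move=> a u v; rewrite -[u]reprK -[v]reprK -piZ -piD.
apply: Blim_eq.
under eq_fun do rewrite oint_scalar mulrDr mulrCA.
by apply: cvgD; [apply: cvgMr|]; exact: cvg_Blim.
Qed.

Lemma Blim_ge0 u : (\forall x \ae leb R, 0 <= u x) -> 0 <= Blim U u.
Proof.
move=> u0; rewrite -[u]reprK.
apply: (cvgr_to_ge (cvg_Blim (repr u))).
apply: filterS (right_gt 0) => x /= x0; apply: mulr_ge0.
  by rewrite invr_ge0 ltW.
rewrite -[leLHS](mul0r (x - 0)); apply: oint_ge_ae; first exact: ltW.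
by apply: filterS u0.
Qed.

Lemma Blim_translate u (t : R) : Blim U (translate t u) = Blim U u.
Proof.
pose f := repr u; apply: Blim_eq.
have [M fM] := essb_bounded f.
(* The translate integrates to the integral of [f] from [0 - t] to [x - t]; splitting at 0 and at
   [x] isolates two end pieces, each bounded by [M * |t|]. *)
have -> : (fun x => x^-1 * oint 0 x (translf t f)) =
    (fun x => x^-1 * oint 0 x f + x^-1 * (oint (0 - t) 0 f + oint x (x - t) f)).
  apply/funext => x; rewrite oint_translf.
  rewrite (oint_split f (0 - t) 0 (x - t)) (oint_split f 0 x (x - t)) -mulrDr.
  by congr (_ * _); lra.
rewrite -[X in _ --> X]addr0; apply: cvgD.
  by rewrite -[in X in _ --> X](reprK u); exact: cvg_Blim.
apply: (@cvg_div_bounded _ (M * `|t| + M * `|t|)) => x.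
apply: le_trans (ler_normD _ _) _; apply: lerD.
  by apply: le_trans (oint_bound _ _ fM) _; rewrite !sub0r opprK.
by apply: le_trans (oint_bound _ _ fM) _; rewrite addrAC subrr sub0r normrN.
Qed.

Lemma Blim_cvg u (l : R) : Linf_cvg_pinfty u l -> Blim U u = l.
Proof.
move=> ul; rewrite -[u]reprK; apply: Blim_eq; set f := repr u.
apply/cvgrPdist_lt => e e0.
have e20 : 0 < e / 2 by rewrite divr_gt0.
have [a ula] := ul _ e20.
(* Strictly beyond [a], so the estimate on [u] holds a.e. on all of [[b, x]], and positive, so that
   [x - b <= x]. *)
pose b := Num.max a 0 + 1.
have [b0 ab] : 0 < b /\ a < b.
  by rewrite /b; split; rewrite ltr_pwDr// le_max lexx ?orbT.
(* The error accumulated on [[0, b]] is independent of [x], so [C / x] is eventually below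
   [e / 2]. *)
pose C := oint 0 b f - l * b.
have /cvgrPdist_lt /(_ _ e20) := cvg_div_bounded (fun=> C) _ (fun=> lexx `|C|).
apply: filterS2 (right_gt b) => x /= bx; rewrite sub0r normrN => Cx.
have x0 : 0 < x by exact: lt_trans bx.
have lo : (l - e / 2) * (x - b) <= oint b x f.
  apply: oint_ge_ae; first exact: ltW.
  apply: filterS ula => y /= H /andP[by_ _]; have := H (lt_le_trans ab by_).
  by rewrite /ball/= ltr_norml /Linf_fun -/f => /andP[]; lra.
have hi : oint b x f <= (l + e / 2) * (x - b).
  apply: oint_le_ae; first exact: ltW.
  apply: filterS ula => y /= H /andP[by_ _]; have := H (lt_le_trans ab by_).
  by rewrite /ball/= ltr_norml /Linf_fun -/f => /andP[]; lra.
have -> : l - x^-1 * oint 0 x f =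
    - (x^-1 * C) - x^-1 * (oint b x f - l * (x - b)).
  rewrite (oint_split f 0 b x) /C; apply: (mulfI (lt0r_neq0 x0)).
  by rewrite !(mulrBr, mulrN, mulrA) divff ?lt0r_neq0// !mul1r; lra.
rewrite [e]splitr; apply: le_lt_trans (ler_normB _ _) _.
rewrite normrN; apply: ltr_leD => //.
rewrite normrM normfV (gtr0_norm x0) ler_pdivrMl//.
(* The error on [[b, x]] is at most [e / 2] times its length, hence at most [e / 2] after division
   by [x]. *)
apply: (@le_trans _ _ (e / 2 * (x - b))).
  by rewrite ler_norml; apply/andP; split; lra.
by rewrite mulrC ler_pM2r//; lra.
Qed.

End Averages.

Theorem proposition6p5 (R : realType) (U : set_system R) :
  right_lebesgue_ultrafilter U -> banach_limit (Blim U).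
Proof.
move=> RLU; split.
- exact: Blim_scalar.
- exact: Blim_ge0.
- exact: Blim_translate.
- exact: Blim_cvg.
Qed.
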